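(* Let $b=q=3$ and $p=2bq=18$. Then $\psi^{(\xi)}(x)\le\tilde\psi_\xi(x)$ for all $x\in[1,b]$. In particular, the function $\psi_0:[1,b]\to\mathbb{R}$, $$\psi_0(x):=\frac{1}{\sqrt3}\sqrt{\mu x^2+\frac{\lambda}{x}},\qquad \mu=\frac{3(p^2b-q^2)}{b^3-1},\quad\lambda=3q^2-\mu,$$ satisfies $\psi_0\le\tilde\psi_\xi$ on $[1,b]$.
   Context: For $s\ge q$ with $3(p^2b-s^2)>b^3-1$ put $$c_s:=\frac{p^3-3pb^2-s^3+3s}{3p^2b-b^3-3s^2+1},\qquad A_s:=\mathrm{Re}(s+\sqrt{-1})^3-c_s\,\mathrm{Im}(s+\sqrt{-1})^3=s^3-3s-c_s(3s^2-1).$$ $\xi:=\inf\{s\ge q:\ 3(p^2b-s^2)>b^3-1,\ s\ge c_s,\ s^2-1\ge2sc_s\}$; for the values $b=q=3$, $p=18$, $\xi\approx3.977$ is the unique root in $(3,6)$ of $F(s)=-s^4+2887s^2-10692s-2890$. $\tilde\psi_\xi:[1,b]\to\mathbb{R}$ is the unique continuous function with $\tilde\psi_\xi(1)=\xi$, $\tilde\psi_\xi(b)=p$ satisfying $$\tilde\psi_\xi^3-3x^2\tilde\psi_\xi-c_\xi(3x\tilde\psi_\xi^2-x^3)=A_\xi\quad\text{for all }x\in[1,b],$$ where $c_\xi=\frac{\xi^2-1}{2\xi}$ and $A_\xi=-\frac{(\xi^2+1)^2}{2\xi}$. For $q\le s<p_\star:=\min\big(p/b,\sqrt{(3p^2b-b^3+1)/3}\big)$,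 $$\psi^{(s)}(x):=\frac{1}{\sqrt3}\sqrt{\mu^{(s)}x^2+\frac{\lambda^{(s)}}{x}},\qquad\mu^{(s)}=\frac{3(p^2b-s^2)}{b^3-1},\quad\lambda^{(s)}=3s^2-\mu^{(s)},$$ so $\psi^{(q)}=\psi_0$. *)

(* Defs.v *)
From Stdlib Require Import Reals.
From Coquelicot Require Import Coquelicot.
Open Scope R_scope.

Definition c_of (b p s : R) : R :=
  (p ^ 3 - 3 * p * b ^ 2 - s ^ 3 + 3 * s) / (3 * p ^ 2 * b - b ^ 3 - 3 * s ^ 2 + 1).

Definition xi_set (b q p s : R) : Prop :=
  q <= s /\ 3 * (p ^ 2 * b - s ^ 2) > b ^ 3 - 1 /\
  s >= c_of b p s /\ s ^ 2 - 1 >= 2 * s * c_of b p s.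

(* [Glb_Rbar] takes values in [Rbar]; [real] sends infinite values to 0, which
   only matters when the set is empty, since it is bounded below by q. *)
Definition xi (b q p : R) : R := real (Glb_Rbar (xi_set b q p)).

(* The constants of the curve of [is_tilde_psi].  At the infimum the constraint
   s^2 - 1 >= 2 s c_s is active, so that c_xi is also [c_of b p (xi b q p)]
   for the values of b, q, p of the theorem. *)
Definition c_xi (b q p : R) : R := ((xi b q p) ^ 2 - 1) / (2 * xi b q p).
Definition A_xi (b q p : R) : R := - (((xi b q p) ^ 2 + 1) ^ 2 / (2 * xi b q p)).

(* Functions on [1,b] are total functions whose values off [1,b] are
   ignored; on [1,b] these conditions determine f.  Such an f exists for
   b = q = 3, p = 18: writing f x = x * t x, the equation reads
   t^3 - 3 c t^2 - 3 t + c = A / x^3, whose left-hand side is increasing in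
   t >= xi and has value A at t = xi. *)
Definition is_tilde_psi (b q p : R) (f : R -> R) : Prop :=
  continuous_on (fun x => 1 <= x <= b) f /\
  f 1 = xi b q p /\ f b = p /\
  forall x, 1 <= x <= b ->
    f x ^ 3 - 3 * x ^ 2 * f x - c_xi b q p * (3 * x * f x ^ 2 - x ^ 3) = A_xi b q p.

Definition mu (b p s : R) : R := 3 * (p ^ 2 * b - s ^ 2) / (b ^ 3 - 1).
Definition lambda (b p s : R) : R := 3 * s ^ 2 - mu b p s.

Definition psi (b p s x : R) : R :=
  / sqrt 3 * sqrt (mu b p s * x ^ 2 + lambda b p s / x).

Definition psi0 (b q p x : R) : R := psi b p q x.

(* Main.v *)
(** Put w = x^3 and u(x,y) = y^3 - 3x^2 y, v(x,y) = c(3xy^2 - x^3) + A, so that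
    the curve of the theorem is u = v.  Along y = psi^(xi)(x) the quantity x y^2 is
    affine in w, hence so is v, and w(v^2 - u^2) is a cubic polynomial in w.  The curve
    and the graph of psi^(xi) meet at x = 1 and x = 3, so this cubic is
    (w-1)(w-27) times an affine function, which is negative on [1,27]; thus
    u <= v along psi^(xi).  On the other hand u - v is increasing in y for y >= xi x,
    and by the intermediate value theorem the curve stays in this region. *)

Require Import Defs.
From Stdlib Require Import Reals Lra Psatz.
From Coquelicot Require Import Coquelicot.
Open Scope R_scope.

(** The numerator of [s ^ 2 - 1 - 2 * s * c_of 3 18 s] over the denominator [2890 - 3 * s ^ 2] of
    [c_of]. *)
Definition quartic (s : R) : R := - s ^ 4 + 2887 * s ^ 2 - 10692 * s - 2890.

Lemma quartic_root : exists r, 3.976 <= r <= 3.978 /\ quartic r = 0.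
Proof.
  destruct (IVT_gen quartic 3.976 3.978 0) as [r [Hr Hr0]].
  - unfold quartic; reg.
  - unfold quartic; split.
    + eapply Rle_trans; [apply Rmin_l | lra].
    + eapply Rle_trans; [| apply Rmax_r]; lra.
  - exists r; split; [| exact Hr0].
    rewrite Rmin_left, Rmax_right in Hr by lra; exact Hr.
Qed.

(** After division of [quartic r - quartic s] by [r - s], the term [2887 * (r + s)] dominates,
    because r + s > 6. *)
Lemma quartic_neg_before_root (r s : R) :
  r <= 3.978 -> quartic r = 0 -> 3 <= s < r -> quartic s < 0.
Proof.
  intros Hr Hr0 Hs.
  assert (E : quartic r - quartic s
    = (r - s) * (2887 * (r + s) - 10692 - (r + s) * (r ^ 2 + s ^ 2)))
    by (unfold quartic; ring).
  assert (0 < 2887 * (r + s) - 10692 - (r + s) * (r ^ 2 + s ^ 2)) by nra.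
  nra.
Qed.

Lemma c_of_le_iff (s : R) :
  3 <= s -> 3 * s ^ 2 < 2890 ->
  2 * s * c_of 3 18 s <= s ^ 2 - 1 <-> 0 <= quartic s.
Proof.
  intros Hs Hd.
  assert (E : (s ^ 2 - 1 - 2 * s * c_of 3 18 s) * (2890 - 3 * s ^ 2) = quartic s)
    by (unfold c_of, quartic; field; lra).
  split; intros H.
  - rewrite <- E; apply Rmult_le_pos; lra.
  - destruct (Rle_lt_dec (2 * s * c_of 3 18 s) (s ^ 2 - 1)) as [|L]; [assumption|].
    nra.
Qed.

Lemma xi_eq_root (r : R) :
  3.976 <= r <= 3.978 -> quartic r = 0 -> xi 3 3 18 = r.
Proof.
  intros Hr Hr0; unfold xi.
  rewrite (is_glb_Rbar_unique _ (Finite r)); [reflexivity|]; split.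
  - intros s [H1 [H2 [_ H4]]]; simpl.
    destruct (Rle_lt_dec r s) as [|L]; [assumption|].
    pose proof (quartic_neg_before_root r s (proj2 Hr) Hr0 (conj H1 L)).
    assert (0 <= quartic s) by (apply c_of_le_iff; lra).
    lra.
  - intros l Hl; apply Hl.
    assert (Hc : 2 * r * c_of 3 18 r <= r ^ 2 - 1) by (apply c_of_le_iff; nra).
    (* The constraint [r >= c_of 3 18 r] follows from [Hc], as r^2 - 1 < 2 r^2. *)
    repeat split; nra.
Qed.

Lemma psi_nonneg (b p s x : R) : 0 <= psi b p s x.
Proof.
  apply Rmult_le_pos; [| apply sqrt_pos].
  left; apply Rinv_0_lt_compat, sqrt_lt_R0; lra.
Qed.

Lemma cube_bounds (x : R) : 1 <= x <= 3 -> 1 <= x ^ 3 <= 27.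
Proof.
  intros Hx; split.
  - rewrite <- (pow1 3); apply pow_incr; lra.
  - replace 27 with (3 ^ 3) by ring; apply pow_incr; lra.
Qed.

Lemma x_psi_sqr (s x : R) :
  s ^ 2 <= 972 -> 1 <= x <= 3 ->
  x * psi 3 18 s x ^ 2 = (972 - s ^ 2) / 26 * (x ^ 3 - 1) + s ^ 2.
Proof.
  intros Hs Hx; pose proof (cube_bounds x Hx) as Hw.
  set (E := mu 3 18 s * x ^ 2 + lambda 3 18 s / x).
  assert (HE : E * x = 3 * ((972 - s ^ 2) / 26 * (x ^ 3 - 1) + s ^ 2))
    by (unfold E, lambda, mu; field; lra).
  (* The radicand must be nonnegative for [sqrt] to square back to it. *)
  assert (0 <= (972 - s ^ 2) / 26 * (x ^ 3 - 1)) by (apply Rmult_le_pos; lra).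
  assert (0 <= E) by nra.
  unfold psi; fold E.
  rewrite Rpow_mult_distr, pow_inv, !pow2_sqrt by lra.
  lra.
Qed.

(** In x psi^2 the coefficient of s^2 is (27 - x^3)/26, nonnegative on [1, 3]. *)
Lemma psi_mono (s t x : R) :
  0 <= s <= t -> t ^ 2 <= 972 -> 1 <= x <= 3 -> psi 3 18 s x <= psi 3 18 t x.
Proof.
  intros Hst Ht Hx; pose proof (cube_bounds x Hx).
  assert (s ^ 2 <= t ^ 2) by (apply pow_incr; lra).
  pose proof (x_psi_sqr s x ltac:(lra) Hx).
  pose proof (x_psi_sqr t x Ht Hx).
  assert (0 <= (t ^ 2 - s ^ 2) * (27 - x ^ 3)) by (apply Rmult_le_pos; lra).
  assert (x * psi 3 18 s x ^ 2 <= x * psi 3 18 t x ^ 2) by lra.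
  assert (psi 3 18 s x ^ 2 <= psi 3 18 t x ^ 2) by nra.
  pose proof (psi_nonneg 3 18 s x); pose proof (psi_nonneg 3 18 t x); nra.
Qed.

(* [(r^3 - 3r) + (5346 - (r^3 - 3r)) / 26 * (w - 1)] is the affine function v of w,
   interpolated from its values at w = 1 and w = 27, which do not involve c. *)
Lemma psi_cubic_le (r x y : R) :
  3.976 <= r <= 3.978 -> 1 <= x <= 3 ->
  x * y ^ 2 = (972 - r ^ 2) / 26 * (x ^ 3 - 1) + r ^ 2 ->
  y ^ 3 - 3 * x ^ 2 * y
  <= r ^ 3 - 3 * r + (5346 - (r ^ 3 - 3 * r)) / 26 * (x ^ 3 - 1).
Proof.
  intros Hr Hx Hy; pose proof (cube_bounds x Hx) as Hw.
  set (k := (5346 - (r ^ 3 - 3 * r)) / 26).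
  set (m := (972 - r ^ 2) / 26) in *.
  set (l := r ^ 2 - m).
  set (u := y ^ 3 - 3 * x ^ 2 * y).
  set (v := r ^ 3 - 3 * r + k * (x ^ 3 - 1)).
  set (w := x ^ 3) in *.
  assert (Hr2 : 15.80 <= r ^ 2 <= 15.83) by nra.
  assert (Hr3 : 62.8 <= r ^ 3 <= 63) by (simpl in *; nra).
  assert (Hk : 203.6 <= k <= 203.7) by (unfold k; lra).
  assert (Hm : 36.77 <= m <= 36.78) by (unfold m; lra).
  assert (Hl : 20.94 <= - l <= 20.98) by (unfold l; lra).
  assert (Hu : w * u ^ 2 = (m * w + l) * ((m - 3) * w + l) ^ 2).
  { replace (w * u ^ 2) with ((x * y ^ 2) * (x * y ^ 2 - 3 * w) ^ 2)
      by (unfold w, u; ring).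
    rewrite Hy; unfold l; ring. }
  (* Given the roots w = 1 and w = 27, the last factor is fixed by the coefficient of w^3 and the
     value -l^3 at w = 0. *)
  assert (Hv : w * v ^ 2 - w * u ^ 2
    = (w - 1) * (27 - w) * ((m * (m - 3) ^ 2 - k ^ 2) * w - (- l) ^ 3 / 27)).
  { rewrite Hu; unfold v, k, l, m; field. }
  assert (H1 : 1140 <= (m - 3) ^ 2) by nra.
  assert (H2 : k ^ 2 <= 41494) by nra.
  assert (H3 : (- l) ^ 3 <= 9300).
  { apply Rle_trans with (20.98 ^ 3); [apply pow_incr|]; lra. }
  (* 345 exceeds 9300/27, so the affine factor is positive already at w = 1. *)
  assert (H4 : 345 <= m * (m - 3) ^ 2 - k ^ 2) by nra.
  assert (H5 : 0 <= (m * (m - 3) ^ 2 - k ^ 2) * w - (- l) ^ 3 / 27) by nra.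
  assert (H6 : 0 <= (w - 1) * (27 - w)) by nra.
  assert (H7 : 0 <= w * v ^ 2 - w * u ^ 2) by (rewrite Hv; apply Rmult_le_pos; assumption).
  assert (H8 : u ^ 2 <= v ^ 2) by nra.
  assert (H9 : 0 <= v) by (unfold v; nra).
  nra.
Qed.

(** Precomposing f with the 1-Lipschitz clamp [pr] onto [a, b] gives a function continuous on all of
    R, as [IVT_gen] demands. *)
Lemma continuous_on_interval_IVT (f : R -> R) (a b : R) :
  a <= b -> continuous_on (fun x => a <= x <= b) f -> f a <= 0 <= f b ->
  exists x, a <= x <= b /\ f x = 0.
Proof.
  intros Hab Hf H0.
  pose (pr := fun t => Rmax a (Rmin t b)).
  assert (Hpr : forall t, a <= pr t <= b).
  { intros t; unfold pr; split; [apply Rmax_l|].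
    apply Rmax_lub; [exact Hab | apply Rmin_r]. }
  assert (Hid : forall t, a <= t <= b -> pr t = t).
  { intros t Ht; unfold pr; rewrite Rmin_left, Rmax_right by lra; reflexivity. }
  destruct (IVT_gen (fun t => f (pr t)) a b 0) as [x [Hx Hx0]].
  - intros t; apply continuity_pt_filterlim.
    eapply filterlim_comp; [| apply (Hf _ (Hpr t))].
    intros P [eps HP]; exists eps; intros u Hu; apply HP; [| apply Hpr].
    eapply Rle_lt_trans; [| exact Hu].
    unfold abs, minus, plus, opp; simpl; unfold pr, Rmax, Rmin.
    repeat destruct Rle_dec; unfold Rabs; repeat destruct Rcase_abs; lra.
  - rewrite !Hid by lra; rewrite Rmin_left, Rmax_right by lra; exact H0.
  - rewrite Rmin_left, Rmax_right in Hx by lra.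
    exists x; rewrite Hid in Hx0 by exact Hx; auto.
Qed.

(* At y = r x the cubic takes the value A x^3, which equals A only for x = 1, so
   a curve ending above the line y = r x cannot cross it. *)
Lemma tilde_psi_ge_line (r c A b : R) (f : R -> R) :
  A < 0 -> r ^ 3 - 3 * r - c * (3 * r ^ 2 - 1) = A ->
  continuous_on (fun x => 1 <= x <= b) f -> f 1 = r -> r * b <= f b ->
  (forall x, 1 <= x <= b ->
    f x ^ 3 - 3 * x ^ 2 * f x - c * (3 * x * f x ^ 2 - x ^ 3) = A) ->
  forall x, 1 <= x <= b -> r * x <= f x.
Proof.
  intros HA Hmin Hf Hf1 Hfb Heq x Hx.
  destruct (Rle_lt_dec (r * x) (f x)) as [|L]; [assumption|].
  destruct (continuous_on_interval_IVT (fun t => f t - r * t) x b) as [z [Hz Hz0]].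
  - lra.
  - intros t Ht; apply filterlim_within_ext with (f := fun t => minus (f t) (r * t)).
    { reflexivity. }
    apply (filterlim_comp_2 _ (fun t => opp (r * t)) plus
             (H := locally (opp (r * t))) (G := locally (f t))
             (F := within (fun u => x <= u <= b) (locally t))).
    + assert (Hf' := Hf t ltac:(lra)).
      intros P HP; generalize (Hf' P HP); unfold filtermap, within.
      apply filter_imp; intros u Hu Hxu; apply Hu; lra.
    + apply (filterlim_filter_le_1 _ (filter_le_within _)).
      apply (ex_derive_continuous (fun u => opp (r * u)) t).
      unfold opp; simpl; auto_derive; auto.
    + apply (filterlim_plus (f t) (opp (r * t))).
  - simpl; lra.
  - simpl in Hz0.
    assert (Hfz : f z = r * z) by lra.
    pose proof (Heq z ltac:(lra)) as E; rewrite Hfz in E.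
    assert (E' : A * (z ^ 3 - 1) = 0) by (rewrite <- Hmin in E |- *; lra).
    assert (z ^ 3 = 1) by nra.
    assert (z = 1) by nra.
    (* Since 1 <= x <= z, also x = 1, where [Hf1] contradicts [L]. *)
    replace x with 1 in L by lra; lra.
Qed.

(** The condition on c makes y = r x a critical point of the cubic in y. Expanded there it has no
    linear term, and its quadratic coefficient 3x(r - c) is positive. *)
Lemma cubic_strict_mono (r c x y z : R) :
  0 < x -> 0 < r -> 2 * r * c = r ^ 2 - 1 -> r * x <= z < y ->
  z ^ 3 - 3 * x ^ 2 * z - c * (3 * x * z ^ 2 - x ^ 3)
  < y ^ 3 - 3 * x ^ 2 * y - c * (3 * x * y ^ 2 - x ^ 3).
Proof.
  intros Hx Hr Hc Hz.
  set (h := y - r * x); set (k := z - r * x).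
  assert (E : y ^ 3 - 3 * x ^ 2 * y - c * (3 * x * y ^ 2 - x ^ 3)
    - (z ^ 3 - 3 * x ^ 2 * z - c * (3 * x * z ^ 2 - x ^ 3))
    = (h - k) * (3 * x ^ 2 * (r ^ 2 - 1 - 2 * r * c)
                 + 3 * (x * (r - c)) * (h + k) + h ^ 2 + h * k + k ^ 2))
    by (unfold h, k; ring).
  rewrite Hc in E.
  assert (0 <= k < h) by (unfold h, k; lra).
  assert (0 < r - c) by nra.
  assert (0 < x * (r - c)) by nra.
  assert (0 <= x * (r - c) * (h + k)) by nra.
  assert (0 < h ^ 2 + h * k + k ^ 2) by nra.
  nra.
Qed.

Theorem lemma3p3 (b q p : R) (tpsi : R -> R)
  (Hb : b = 3) (Hq : q = 3) (Hp : p = 2 * b * q)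
  (Htpsi : is_tilde_psi b q p tpsi) :
  (forall x, 1 <= x <= b -> psi b p (xi b q p) x <= tpsi x) /\
  (forall x, 1 <= x <= b -> psi0 b q p x <= tpsi x).
Proof.
  assert (Hp' : p = 18) by (subst; lra).
  clear Hp; subst b q p.
  destruct quartic_root as [r [Hr Hr0]].
  destruct Htpsi as [Hcont [H1 [H3 Heq]]].
  unfold c_xi, A_xi in Heq.
  rewrite (xi_eq_root r Hr Hr0) in *.
  set (c := (r ^ 2 - 1) / (2 * r)) in *.
  set (A := - ((r ^ 2 + 1) ^ 2 / (2 * r))) in *.
  assert (Hc : 2 * r * c = r ^ 2 - 1) by (unfold c; field; lra).
  assert (HA1 : r ^ 3 - 3 * r - c * (3 * r ^ 2 - 1) = A) by (unfold c, A; field; lra).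
  assert (HA3 : 5346 - 2889 * c = A).
  { pose proof (Heq 3 ltac:(lra)) as E; rewrite H3 in E; lra. }
  assert (HA : A < 0).
  { unfold A; apply Ropp_lt_gt_0_contravar, Rdiv_lt_0_compat; nra. }
  assert (Hline := tilde_psi_ge_line r c A 3 tpsi HA HA1 Hcont H1 ltac:(lra) Heq).
  assert (Hmain : forall x, 1 <= x <= 3 -> psi 3 18 r x <= tpsi x).
  { intros x Hx.
    destruct (Rle_lt_dec (psi 3 18 r x) (tpsi x)) as [|L]; [assumption|].
    pose proof (x_psi_sqr r x ltac:(nra) Hx) as Hy.
    pose proof (psi_cubic_le r x _ Hr Hx Hy) as Hle.
    pose proof (cubic_strict_mono r c x _ _ ltac:(lra) ltac:(lra) Hc
                  (conj (Hline x Hx) L)) as Hlt.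
    rewrite (Heq x Hx) in Hlt.
    set (y := psi 3 18 r x) in *.
    (* Both sides are affine in x^3; they agree at x = 1 by [HA1] and at x = 3 by [HA3]. *)
    assert (c * (3 * x * y ^ 2 - x ^ 3) + A
      = r ^ 3 - 3 * r + (5346 - (r ^ 3 - 3 * r)) / 26 * (x ^ 3 - 1)).
    { replace (3 * x * y ^ 2) with (3 * (x * y ^ 2)) by ring; rewrite Hy.
      replace 5346 with (A + 2889 * c) by lra.
      rewrite <- HA1; field. }
    lra. }
  split; [exact Hmain|].
  intros x Hx; eapply Rle_trans; [| apply Hmain, Hx].
  apply psi_mono; nra.
Qed.
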